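(* Let $\Gamma$ be a metric graph with vertex set $V(\Gamma)$ (containing the topological vertices) and edge set $E(\Gamma)$. Let $v\in V(\Gamma)$ and $D\in\mathrm{Div}(\Gamma)$. Then $D$ is $v$-reduced if and only if the following conditions are satisfied: (1) $D$ is nonnegative on $\Gamma\setminus\{v\}$; (2) for all edges $e\in E(\Gamma)$, we have $\sum_{p\in e^\circ} D(p)\le 1$; (3) there is a total order $\prec$ on $V(\Gamma)$, $v=v_0\prec v_1\prec\cdots\prec v_r$, such that $\tilde D(v_i)<\tilde d(v_i)$ for all $v_i\in V(\Gamma)\setminus\{v\}$, where $$\tilde D(v_i):=D(v_i)+\sum_{\ell<i}\ \sum_{e=(v_\ell,v_i)}\ \sum_{p\in e^\circ} D(p)\quad\text{and}\quad \tilde d(v_i):=\sharp\{e=(v_i,v_\ell)\in E(\Gamma)\mid \ell<i\};$$ (4) moreover (for this same order), for all $v_i,v_j\in V(\Gamma)\setminus\{v\}$: if $v_i\prec v_j$ and $$D(v_j)+\sum_{\ell<i}\ \sum_{e=(v_j,v_\ell)}\ \sum_{p\in e^\circ} D(p)\ <\ \sharp\{e=(v_\ell,v_j)\in E(\Gamma)\mid \ell<i\},$$ then $$\tilde D(v_i)\le D(v_j)+\sum_{\ell<i}\ \sum_{e=(v_j,v_\ell)}\ \sum_{p\in e^\circ} D(p).$$ (The right-hand side is smaller than or equal to $\tilde D(v_j)$.)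
   Context: Metric graphs are compact and connected, with arbitrary positive edge lengths; $e^\circ$ denotes the interior of an edge $e$. A divisor $D$ on $\Gamma$ is a finite formal $\mathbb{Z}$-linear combination of points of $\Gamma$, and $D(p)$ denotes its coefficient at $p$. The notation $e=(u,w)$ means an edge $e$ with endpoints $u$ and $w$; the sums range over all such edges (with multiplicity if there are parallel edges). Let $X$ be a (nonempty) closed connected subset of $\Gamma$. Given $p\in\partial X$, the outgoing degree $\mathrm{outdeg}_X(p)$ is the maximum number of internally disjoint segments in $\Gamma\setminus X$ with an open end in $p$. A boundary point $p\in\partial X$ is saturated with respect to $X$ and $D$ if $D(p)\ge\mathrm{outdeg}_X(p)$, and non-saturated otherwise. A divisor $D$ is $p$-reduced if it is effective in $\Gamma\setminus\{p\}$ (i.e. $D(q)\ge 0$ for all $q\ne p$) and each closed connected subset $X\subseteq\Gamma\setminus\{p\}$ contains a non-saturated boundary point. *)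

(* Defs.v *)
(* MathComp-Analysis *)
From HB Require Import structures.
From mathcomp Require Export all_boot all_order all_algebra finmap.
From mathcomp Require Export all_classical all_reals all_analysis.
Export Order.TTheory GRing.Theory Num.Theory.
Export numFieldNormedType.Exports.

Set Implicit Arguments.
Unset Strict Implicit.
Unset Printing Implicit Defensive.

Local Open Scope classical_set_scope.
Local Open Scope ring_scope.

(** A finite multigraph (loops and parallel edges allowed) with positive edge
    lengths; the orientation src -> tgt only serves to parametrize edges. *)
Record metric_graph (R : realType) := MetricGraph {
  vert : finType;
  edge : finType;
  src : edge -> vert;
  tgt : edge -> vert;
  len : edge -> R;
  len_gt0 : forall e, 0 < len e }.

Section MetricGraph.
Context {R : realType} (G : metric_graph R).

(** The underlying set of Gamma: the vertices, and for each edge e the points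
    at distance t from [src e], 0 < t < len e.  Every point which is not a
    vertex has valence 2, so [vert G] contains the topological vertices. *)
Definition points : Type :=
  (vert G + {e : edge G & {t : R | 0 < t < len e}})%type.

HB.instance Definition _ := Choice.on points.

Definition vertex (u : vert G) : points := inl u.

(** The parametrization [0, len e] -> Gamma of the edge e, extended to R by
    the constants [src e] on the left and [tgt e] on the right. *)
Definition chart (e : edge G) (t : R) : points :=
  if insub t is Some s
  then inr (existT (fun e => {t : R | 0 < t < len e}) e s)
  else vertex (if t <= 0 then src e else tgt e).

(** Gamma has the quotient topology from the disjoint union of the vertices
    (discrete) and the intervals [0, len e]; this is also the topology of the
    path metric, and it is compact since the graph is finite.  As clamping
    R -> [0, len e] is a quotient map, openness can be tested on the extended
    parametrizations. *)
Definition points_open (U : set points) : Prop :=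
  forall e, open (chart e @^-1` U).

Fact points_openT : points_open setT.
Proof. by move=> e; rewrite preimage_setT; exact: openT. Qed.

Fact points_openI : setI_closed points_open.
Proof. by move=> A B oA oB e; rewrite preimage_setI; exact: openI. Qed.

Fact points_open_bigcup (I : Type) (f : I -> set points) :
  (forall i, points_open (f i)) -> points_open (\bigcup_i f i).
Proof.
by move=> of_ e; rewrite preimage_bigcup; apply: bigcup_open => i _; exact: of_.
Qed.

HB.instance Definition _ := isOpenTopological.Build points
  points_openT points_openI points_open_bigcup.

Definition edge_interior (e : edge G) : set points :=
  chart e @` [set t | 0 < t < len e].

Definition joins (e : edge G) (u w : vert G) : bool :=
  ((src e == u) && (tgt e == w)) || ((src e == w) && (tgt e == u)).

Definition boundary (X : set points) : set points := closure X `\` X°.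

(** g parametrizes a segment g(]0,1]) of Gamma \ X with an open end in p. *)
Definition outgoing_segment (X : set points) (p : points) (g : R -> points) :=
  [/\ {within `[0, 1], continuous g},
      {in `[0, 1] &, injective g},
      g 0 = p &
      forall t, 0 < t <= 1 -> ~ X (g t)].

Definition has_outgoing_segments (X : set points) (p : points) (k : nat) :=
  exists g : 'I_k -> R -> points,
    (forall i, outgoing_segment X p (g i)) /\
    trivIset setT (fun i => g i @` [set t | 0 < t < 1]).

(** The maximum is attained, k being bounded by the valence of p; the default
    value 0 is thus never used. *)
Definition outdeg (X : set points) (p : points) : nat :=
  xget 0%N [set k | has_outgoing_segments X p k /\
                    forall m, has_outgoing_segments X p m -> (m <= k)%N].

Definition divisor := {fsfun points -> int with 0}.

Definition saturated (X : set points) (D : divisor) (p : points) : Prop :=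
  (outdeg X p)%:Z <= D p.

Definition reduced (p : points) (D : divisor) : Prop :=
  (forall q, q != p -> 0 <= D q) /\
  (forall X : set points, X !=set0 -> closed X -> connected X -> ~ X p ->
     exists2 q, boundary X q & ~ saturated X D q).

Definition edge_chips (D : divisor) (e : edge G) : int :=
  \sum_(p \in edge_interior e) D p.

(** prec is a strict total order whose least element is v. *)
Definition order_from (v : vert G) (prec : rel (vert G)) : Prop :=
  [/\ irreflexive prec, transitive prec,
      (forall u w, u != w -> prec u w || prec w u) &
      (forall u, u != v -> prec v u)].

(** With u = v_j, b = v_i and prec the order, the sum ranges over the l < i;
    tilde D and tilde d are the case b = u.  A loop at u joins u only to itself
    and so is not counted when b is u or precedes u. *)
Definition chips_before (prec : rel (vert G)) (D : divisor) (b u : vert G)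
    : int :=
  D (vertex u) + \sum_(w | prec w b) \sum_(e | joins e w u) edge_chips D e.

Definition edges_before (prec : rel (vert G)) (b u : vert G) : nat :=
  #|[set e | [exists w, prec w b && joins e w u]]%SET|.

Definition Dtilde (prec : rel (vert G)) (D : divisor) (u : vert G) : int :=
  chips_before prec D u u.

Definition dtilde (prec : rel (vert G)) (u : vert G) : nat :=
  edges_before prec u u.

End MetricGraph.

(* Main.v *)
Require Import Defs.
From mathcomp Require Import lra zify.

(** Reducedness and the conditions on the order are two views of Dhar's burning
    process.  A fire starts at [v] and runs along the edges; a vertex burns as
    soon as the number of burnt edges arriving at it exceeds its chips, and an
    interior chip stops the fire coming from one end of its edge.  The divisor is
    reduced exactly when the whole graph burns and no edge carries two chips, and
    the order records in which sequence the vertices burn.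

    The link with the definition is the computation of [outdeg].  Near a point,
    Gamma is a star, with one branch for each tangent direction.  An outgoing
    segment covers the beginning of one branch ([segment_germ]), so internally
    disjoint segments use different branches ([outdeg_le]); conversely each
    branch that is locally outside [X] carries a segment ([outdeg_ge]).  Thus
    outgoing degrees become numbers of branches.

    From the order to reducedness ([reduced_of_order]): let [X] be a closed set
    off [v].  If it contains a vertex, let [u] be its first vertex.  Each edge
    from [u] to a predecessor leaves [X], either at [u], adding one to the
    outgoing degree of [u], or at an interior point.  If all boundary points are
    saturated, the latter point holds a chip, and so does [u] for each edge of
    the former kind; altogether there are at least as many chips as edges,
    against the hypothesis on [u] ([unsaturated_vertex]).  If [X] contains no
    vertex, its two extreme points on an edge would hold two chips
    ([unsaturated_edge]).

    From reducedness to the order: two chips on an edge bound a saturated segment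
    ([reduced_edge]).  Given a proper set [S] of burnt vertices, if no further
    vertex could burn, a component of the unburnt part of Gamma would be a closed
    connected set of saturated points ([all_burnt]).  Hence some vertex can
    always be burnt; choosing each time one with the fewest chips produces the
    required order ([burning_step], [greedy_order]). *)

Set Implicit Arguments.
Unset Strict Implicit.
Unset Printing Implicit Defensive.

Local Open Scope classical_set_scope.
Local Open Scope ring_scope.

(** * Directed edges and tangent directions *)

Section Rays.
Context {R : realType} (G : metric_graph R).
Implicit Types (e : edge G) (d : edge G * bool) (p q : points G) (X : set (points G)).

Lemma chart_le0 e t : t <= 0 -> chart e t = vertex (src e).
Proof.
move=> t0; rewrite /chart t0; case: insubP => // s /andP[s0 _]; exfalso; lra.
Qed.

Lemma chart_ge_len e t : len e <= t -> chart e t = vertex (tgt e).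
Proof.
move=> let_; have l0 := len_gt0 e; rewrite /chart.
case: insubP => [s /andP[_ s1]|_]; first by exfalso; lra.
by case: ifP => // ?; exfalso; lra.
Qed.

(** A first-order view of [points]: equalities between points of edge interiors
    become equalities of pairs, without dependent types. *)
Definition edge_pos p : option (edge G * R) :=
  if p is inr (existT e s) then Some (e, val s) else None.

Lemma edge_pos_chart e t :
  edge_pos (chart e t) = if 0 < t < len e then Some (e, t) else None.
Proof. by rewrite /chart; case: insubP => [s -> <-|/negbTE->]. Qed.

Lemma pointP p : (exists u, p = vertex u) \/
  exists e t, 0 < t < len e /\ p = chart e t.
Proof.
case: p => [u|[e s]]; first by left; exists u.
by right; exists e, (val s); split; [exact: (valP s)|rewrite /chart valK].
Qed.

Lemma chart_continuous e : continuous (chart e).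
Proof. by apply/continuousP => U oU; exact: (oU e). Qed.

(** A directed edge is a pair [(e, b)], traversed from [tgt e] to [src e] when
    [b] holds.  Everything about an edge can then be proved at one end only. *)
Definition flip d : edge G * bool := (d.1, ~~ d.2).

Lemma flipK : involutive flip.
Proof. by case=> e b; rewrite /flip negbK. Qed.

Definition ray d t : points G :=
  chart d.1 (if d.2 then len d.1 - t else t).

Definition tail d : vert G := if d.2 then tgt d.1 else src d.1.

Lemma ray_flip d t : ray (flip d) t = ray d (len d.1 - t).
Proof. by case: d => e [] //; rewrite /ray/flip /= subKr. Qed.

Lemma chart_ray e b t : chart e t = ray (e, b) (if b then len e - t else t).
Proof. by case: b; rewrite /ray //= subKr. Qed.

Lemma ray_le0 d t : t <= 0 -> ray d t = vertex (tail d).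
Proof.
case: d => e [] t0; rewrite /ray/tail/=; last exact: chart_le0.
by apply: chart_ge_len; lra.
Qed.

Lemma ray0 d : ray d 0 = vertex (tail d).
Proof. exact: ray_le0. Qed.

Lemma ray_ge_len d t : len d.1 <= t -> ray d t = vertex (tail (flip d)).
Proof.
by move=> lt_; rewrite -[d]flipK ray_flip ray_le0 ?flipK//= subr_le0.
Qed.

Lemma ray_continuous d : continuous (ray d).
Proof.
case: d => e [] t; rewrite /ray/=; last exact: chart_continuous.
apply: (@continuous_comp _ _ _ (fun t => len e - t) (chart e)).
  by apply: continuousB; [exact: cvg_cst|exact: cvg_id].
exact: chart_continuous.
Qed.

Lemma edge_pos_ray d t : edge_pos (ray d t) =
  if 0 < t < len d.1 then Some (d.1, if d.2 then len d.1 - t else t) else None.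
Proof.
rewrite edge_pos_chart; case: d => e [] //=.
by rewrite subr_gt0 ltrBlDr ltrDl andbC.
Qed.

Lemma ray_interior d t : 0 < t < len d.1 -> edge_interior d.1 (ray d t).
Proof.
move=> ti; exists (if d.2 then len d.1 - t else t) => //=.
by case: d.2 => //; lra.
Qed.

Lemma interior_ray d p : edge_interior d.1 p ->
  exists2 t, 0 < t < len d.1 & p = ray d t.
Proof.
case: d => e b [t /= ti <-]; exists (if b then len e - t else t).
  by case: b => //; apply/andP; split; lra.
exact: chart_ray.
Qed.

Lemma ray_neq_vertex d t u : 0 < t < len d.1 -> ray d t <> vertex u.
Proof. by move=> ti /(congr1 edge_pos); rewrite edge_pos_ray ti. Qed.

Lemma ray_vertex d t u : 0 <= t < len d.1 -> ray d t = vertex u ->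
  t = 0 /\ tail d = u.
Proof.
move=> /andP[t0 tl] du; move: t0; rewrite le_eqVlt => /predU1P[t0|t0].
  by split=> //; move: du; rewrite -t0 ray0 => -[].
by case: (ray_neq_vertex _ du); rewrite t0.
Qed.

Lemma ray_inj d t t' : 0 <= t < len d.1 -> 0 <= t' < len d.1 ->
  ray d t = ray d t' -> t = t'.
Proof.
move=> /andP[t0 tl] /andP[t0' tl'] /(congr1 edge_pos); rewrite !edge_pos_ray.
rewrite tl tl' !andbT; case: ltP => t1; case: ltP => t1' //.
  by case: d.2 => -[] //; lra.
by move=> _; apply/eqP; rewrite eq_le; apply/andP; split; lra.
Qed.

Lemma ray_eq d d' t t' : 0 < t < len d.1 -> ray d t = ray d' t' ->
  (d' = d /\ t' = t) \/ (d' = flip d /\ t' = len d.1 - t).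
Proof.
move=> ti /(congr1 edge_pos); rewrite !edge_pos_ray ti.
case: (boolP (0 < t' < len d'.1)) => // _.
case: d d' {ti} => [e b] [e' b'] /= [<- tt'].
case: b b' tt' => [] [] tt'; [left|right|right|left]; split=> //; lra.
Qed.

Lemma edge_directed e u w : joins e w u ->
  exists b, tail (e, b) = u /\ tail (flip (e, b)) = w.
Proof.
case/orP => /andP[/eqP es /eqP et]; [exists true|exists false]; by split.
Qed.

(** A directed edge also stands for a tangent direction at each point that it
    passes through, except its end.  A vertex has one tangent direction per
    directed edge leaving it, hence two for a loop, and an interior point of an
    edge has two, which are mutual flips. *)
Definition departs p d s := 0 <= s < len d.1 /\ ray d s = p.

Lemma departs_uniq p d s s' : departs p d s -> departs p d s' -> s = s'.
Proof. by move=> [si <-] [si' /esym]; exact: ray_inj. Qed.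

Lemma departs_interior d t d' s : 0 < t < len d.1 ->
  departs (ray d t) d' s -> d' = d /\ s = t \/ d' = flip d /\ s = len d.1 - t.
Proof. by move=> ti [si /esym/(ray_eq ti)]. Qed.

Lemma departs_vertex u d s : departs (vertex u) d s -> s = 0 /\ tail d = u.
Proof. by move=> [si]; exact: ray_vertex. Qed.

Lemma departs_ray d t : 0 <= t < len d.1 -> departs (ray d t) d t.
Proof. by []. Qed.

Definition germ_in X d s := \forall t \near s^'+, X (ray d t).

Lemma germ_inP X d s : s < len d.1 ->
  germ_in X d s <->
  exists2 r, s < r < len d.1 & forall t, s < t < r -> X (ray d t).
Proof.
move=> sl; split=> [/nbhs_ballP[/= r r0 rX]|[r /andP[sr rl] rX]].
  have srl : s < Num.min (s + r) (len d.1) by rewrite lt_min ltrDl r0.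
  exists ((s + Num.min (s + r) (len d.1)) / 2).
    have : Num.min (s + r) (len d.1) <= len d.1 by rewrite ge_min lexx orbT.
    by move=> ?; apply/andP; split; lra.
  have : Num.min (s + r) (len d.1) <= s + r by rewrite ge_min lexx.
  move=> ? t /andP[st tr]; apply: rX => //.
  by rewrite /ball/= ltr_distlC; apply/andP; split; lra.
near=> t; apply: rX; apply/andP; split; near: t.
  exact: nbhs_right_gt.
exact: nbhs_right_lt.
Unshelve. all: by end_near. Qed.

Lemma nbhs_germ p X d s : nbhs p X -> departs p d s -> germ_in X d s.
Proof.
by move=> pX [_ dp]; apply: (cvg_at_right_filter (@ray_continuous d s)); rewrite dp.
Qed.

(** Neighbourhoods are detected direction by direction: the points of [X] all
    of whose germs lie in [X] form an open set [V].  Openness of the preimage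
    of [V] in a chart is checked to the right of each parameter, the left side
    being the right side for the flipped edge. *)
Lemma nbhs_germs p X : X p ->
  (forall d s, departs p d s -> germ_in X d s) -> nbhs p X.
Proof.
move=> Xp pX.
pose V : set (points G) :=
  [set q | X q /\ forall d s, departs q d s -> germ_in X d s].
suff oV : open V by rewrite nbhsE; exists V; [split|move=> q []].
have right d t : V (ray d t) ->
    exists2 r, t < r & forall t', t < t' < r -> V (ray d t').
  move=> Vt; case: (ltP t 0) => [t0|t0].
    by exists 0 => // t' /andP[_ t'0]; rewrite !ray_le0 ?ltW // in Vt *.
  case: (ltP t (len d.1)) => [tl|lt]; last first.
    exists (t + 1); first by rewrite ltrDl.
    move=> t' /andP[tt' _].
    by rewrite !ray_ge_len // in Vt *; exact: (le_trans lt (ltW tt')).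
  have [|r /andP[tr rl] rX] := (germ_inP X tl).1.
    by apply: Vt.2; apply: departs_ray; rewrite t0.
  exists r => // t' /andP[tt' t'r].
  have t'i : 0 < t' < len d.1.
    by rewrite (le_lt_trans t0 tt') (lt_trans t'r rl).
  split; first by apply: rX; rewrite tt'.
  move=> d' s /(departs_interior t'i) [[-> ->]|[-> ->]]; apply/germ_inP.
  - by case/andP: t'i.
  - exists r; first by rewrite t'r.
    by move=> w /andP[tw wr]; apply: rX; rewrite (lt_trans tt').
  - by rewrite /= ltrBlDr ltrDl; case/andP: t'i.
  - exists (len d.1 - (t + t') / 2); first by rewrite /=; apply/andP; split; lra.
    move=> w /andP[tw wr]; rewrite ray_flip; apply: rX.
    by apply/andP; split; lra.
move=> e; rewrite openE => t Vt.
have [r tr rV] := right (e, false) t Vt.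
have [|l tl lV] := right (e, true) (len e - t).
  by rewrite /ray /= subKr.
rewrite /interior; near=> t'.
have lt' : len e - l < t' by near: t'; apply: lt_nbhsr; lra.
have t'r : t' < r by near: t'; exact: lt_nbhsl.
case: (ltgtP t' t) => [t't|tt'|->//].
- suff : V (ray (e, true) (len e - t')) by rewrite /ray/= subKr.
  by apply: lV; apply/andP; split; lra.
- by apply: (rV t'); rewrite tt'.
Unshelve. all: by end_near. Qed.

End Rays.

(** * Topology of the graph *)

Section Topology.
Context {R : realType} (G : metric_graph R).
Implicit Types (e : edge G) (d : edge G * bool) (p q : points G) (X : set (points G)).

Lemma germ_inC X d s : germ_in X d s -> germ_in (~` X) d s -> False.
Proof.
by move=> dX dnX; have [t []] := filter_ex (filterI dX dnX).
Qed.

Lemma nbhs_ray X d s t u : 0 <= s -> u <= len d.1 -> s < t < u ->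
  (forall w, s < w < u -> X (ray d w)) -> nbhs (ray d t) X.
Proof.
move=> s0 ul /andP[st tu] suX; apply: nbhs_germs.
  by apply: suX; rewrite st.
have ti : 0 < t < len d.1 by apply/andP; split; lra.
move=> d' w /(departs_interior ti) [] [-> ->]; rewrite /germ_in.
  near=> v; apply: suX; apply/andP; split.
    by apply: (lt_trans st); near: v; exact: nbhs_right_gt.
  by near: v; exact: nbhs_right_lt.
near=> v; rewrite ray_flip; apply: suX.
have : len d.1 - t < v by near: v; exact: nbhs_right_gt.
have : v < len d.1 - s by near: v; apply: nbhs_right_lt; lra.
by move=> ? ?; apply/andP; split; lra.
Unshelve. all: by end_near. Qed.

Lemma closed_vertex (u : vert G) : closed [set vertex u : points G].
Proof.
rewrite -openC openE => p pu; apply: nbhs_germs => // d s [/andP[s0 sl] _].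
rewrite /germ_in; near=> t; apply: ray_neq_vertex.
have st : s < t by near: t; exact: nbhs_right_gt.
by rewrite (le_lt_trans s0 st) /=; near: t; exact: nbhs_right_lt.
Unshelve. all: by end_near. Qed.

Lemma closed_ray d a b : 0 <= a -> b <= len d.1 ->
  closed [set ray d t | t in `[a, b]].
Proof.
move=> a0 bl; rewrite -openC openE => p nAp.
apply: nbhs_germs => // d' s [/andP[s0 sl] dp].
have near_lt c : \forall t \near s^'+, s < c -> t < c.
  have [sc|cs] := ltP s c; last by near=> t.
  by near=> t => _; near: t; exact: nbhs_right_lt.
rewrite /germ_in; near=> t.
have st : s < t by near: t; exact: nbhs_right_gt.
have tl : t < len d'.1 by near: t; exact: nbhs_right_lt.
have ti : 0 < t < len d'.1 by rewrite (le_lt_trans s0 st).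
have ta : s < a -> t < a by near: t; exact: near_lt.
have tb : s < len d'.1 - b -> t < len d'.1 - b by near: t; exact: near_lt.
move=> [u /=]; rewrite in_itv /= => /andP[au ub] /esym/(ray_eq ti) [] [dd' ut].
  have [/ta|as_] := ltP s a; first by lra.
  by apply: nAp; exists s; rewrite /= ?in_itv/= ?dd' //; apply/andP; split; lra.
have [/tb|bs] := ltP s (len d'.1 - b); first by lra.
apply: nAp; exists (len d'.1 - s).
  by rewrite /= in_itv /=; apply/andP; split; lra.
by rewrite dd' ray_flip subKr.
Unshelve. all: by end_near. Qed.

Lemma closed_point p : closed [set p].
Proof.
have [[u ->]|[e [t [ti ->]]]] := pointP p; first exact: closed_vertex.
have := @closed_ray (e, false) t t; rewrite set_itv1 image_set1.
by apply => /=; case/andP: ti => ? ?; lra.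
Qed.

Lemma connected_ray d a b : connected [set ray d t | t in `[a, b]].
Proof.
apply: connected_continuous_connected; last first.
  by apply: continuous_subspaceT; exact: ray_continuous.
by apply/connected_intervalP; exact: interval_is_interval.
Qed.

(** The hypothesis says that [A] misses the boundary of [W], so that [W] is
    clopen relatively to [A]. *)
Lemma connected_sub_closed (A W : set (points G)) : connected A -> closed W ->
  (forall q, A q -> W q -> nbhs q W) -> A `&` W !=set0 -> A `<=` W.
Proof.
move=> cA clW AW AW0; suff <- : A `&` W = A by move=> x [].
apply: cA => //; last by exists W.
exists W°; first exact: open_interior.
apply/seteqP; split=> q [Aq Wq]; split=> //; first exact: AW.
exact: interior_subset.
Qed.

Lemma boundary_sub X : closed X -> boundary X `<=` X.
Proof. by move=> clX q [/clX]. Qed.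

(** The supremum of the parameters of points of [X] is attained, as [X] is
    closed, and everything after it is outside [X]. *)
Lemma last_exit X d a : closed X -> 0 <= a < len d.1 -> X (ray d a) ->
  ~ X (ray d (len d.1)) ->
  exists b, [/\ a <= b < len d.1, X (ray d b) & germ_in (~` X) d b].
Proof.
move=> clX /andP[a0 al] Xa nXl.
pose P := [set t : R | a <= t <= len d.1 /\ X (ray d t)].
have clP : closed P.
  have -> : P = `[a, len d.1] `&` ray d @^-1` X.
    by apply/seteqP; split=> t; rewrite /= in_itv.
  apply: closedI; first exact: itv_closed.
  by apply: closed_comp => // t _; exact: ray_continuous.
have P0 : P !=set0 by exists a; split; rewrite ?lexx ?ltW.
have ubP : ubound P (len d.1) by move=> t [/andP[]].
have bP : has_ubound P by exists (len d.1).
have [] : P (sup P) by apply: clP; exact: closure_sup.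
set b := sup P => /andP[ab bl] Xb.
have {}bl : b < len d.1.
  by rewrite lt_neqAle bl andbT; apply/eqP => bl'; apply: nXl; rewrite -bl'.
exists b; split=> //; first by rewrite ab.
rewrite /germ_in; near=> t => /= Xt.
have bt : b < t by near: t; exact: nbhs_right_gt.
suff : t <= b by lra.
apply: (ub_le_sup bP); split=> //.
rewrite (le_trans ab (ltW bt)) /=; near: t.
exact: nbhs_right_le.
Unshelve. all: by end_near. Qed.

(** Otherwise each direction at [p] has arbitrarily close points off the
    segment; cutting the star of [p] at such points, near enough to leave out
    the midpoint of the segment, yields a closed set [W] whose boundary the
    segment does not meet, although the segment starts inside and leaves. *)
Lemma segment_germ X p g : outgoing_segment X p g ->
  exists d s, departs p d s /\ germ_in (g @` [set t | 0 < t < 1]) d s.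
Proof.
move=> [cg ig g0 gX]; apply: contrapT => noseg.
pose I := g @` [set t | 0 < t < 1].
have h01 : (2^-1 : R) \in `[0, 1] by rewrite in_itv /=; apply/andP; split; lra.
have i01 : (0 : R) \in `[0, 1] by rewrite in_itv /= lexx ler01.
have gh : g (2^-1) <> p.
  by rewrite -g0 => /ig-/(_ h01 i01) h; clear -h; lra.
have cut d : exists st : R * R, forall s, departs p d s ->
    [/\ departs p d st.1, st.1 < st.2 < len d.1, ~ I (ray d st.2) &
        forall u, st.1 <= u <= st.2 -> ray d u <> g (2^-1)].
  have [[s dps]|nd] := pselect (exists s, departs p d s); last first.
    by exists 0 => s ds; case: nd; exists s.
  have /andP[s0 sl] := dps.1.
  have [r /andP[sr rl] rP] : exists2 r, s < r < len d.1 &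
      forall u, s < u < r -> ray d u <> g (2^-1).
    have [[r [/andP[sr rl] rg]]|nr] :=
        pselect (exists r, s < r < len d.1 /\ ray d r = g (2^-1)).
      exists r; first by rewrite sr.
      move=> u /andP[su ur] ug.
      suff : u = r by lra.
      by apply: (@ray_inj _ _ d); rewrite ?ug //; apply/andP; split; lra.
    exists ((s + len d.1) / 2); first by apply/andP; split; lra.
    by move=> u /andP[su ur] ug; apply: nr; exists u; split=> //; apply/andP; split; lra.
  have [t [/andP[st tr] tI]] : exists t, s < t < r /\ ~ I (ray d t).
    apply: contrapT => nt; apply: noseg; exists d, s; split=> //.
    apply/(germ_inP _ sl); exists r; first by rewrite sr.
    by move=> t str; apply: contrapT => ?; apply: nt; exists t.
  exists (s, t) => _ _; split => //=; first by apply/andP; split; lra.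
  move=> u /andP[]; rewrite le_eqVlt => /predU1P[<-|su] ut.
    by case: dps => _ ->; apply/nesym.
  by apply: rP; rewrite su; lra.
have {cut} [st stP] := choice cut.
pose A := [set d | exists s, departs p d s].
(* Each direction [d] at [p] has a parameter [(st d).1] at [p] and a cut
   [(st d).2], beyond which [W] does not extend. *)
pose W := [set p] `|` \bigcup_(d in A) [set ray d t | t in `[(st d).1, (st d).2]].
have clW : closed W.
  apply: closedU; first exact: closed_point.
  apply: closed_bigcup => [|d [s]]; first exact: finite_finset.
  move=> /stP[[/andP[? ?] _] /andP[? ?] _ _].
  by apply: closed_ray => //; exact: ltW.
have Wp : nbhs p W.
  apply: nbhs_germs; first by left.
  move=> d s ds; have Ad : A d by exists s.
  have [d1 /andP[d2 d3] _ _] := stP _ _ ds.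
  rewrite (departs_uniq ds d1).
  apply/germ_inP; first exact: lt_trans d3.
  exists (st d).2; first by rewrite d2.
  move=> t /andP[? ?]; right; exists d => //; exists t => //=.
  by rewrite in_itv /= !ltW.
have cB : connected (g @` `[0, 2^-1]).
  apply: connected_continuous_connected.
    by apply/connected_intervalP; exact: interval_is_interval.
  apply: continuous_subspaceW cg => t /=; rewrite !in_itv/= => /andP[? ?].
  by apply/andP; split; lra.
have /(_ (g (2^-1))) : g @` `[0, 2^-1] `<=` W.
  apply: connected_sub_closed => //; last first.
    exists p; split; last by left.
    by exists 0 => //=; rewrite in_itv /=; apply/andP; split; lra.
  move=> q [t /=]; rewrite in_itv /= => /andP[t0 t1] <- [->//|[d Ad [u /=]]].
  rewrite in_itv /= => /andP[su ut] dut.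
  move: t0; rewrite le_eqVlt => /predU1P[<-|t0]; first by rewrite g0.
  have It : I (ray d u) by rewrite dut; exists t => //=; apply/andP; split; lra.
  case: (Ad) => s /stP[[/andP[s0 _] ds] /andP[_ ul] nI _].
  move: su; rewrite le_eqVlt => /predU1P[su|su]; first by rewrite -dut -su ds.
  move: ut; rewrite le_eqVlt => /predU1P[ut|ut]; first by rewrite -ut in nI.
  rewrite -dut; apply: (nbhs_ray s0 (ltW ul)); first by rewrite su.
  move=> w /andP[? ?]; right; exists d => //.
  by exists w => //=; rewrite in_itv /= !ltW.
case.
- by exists (2^-1); rewrite //= in_itv /= lexx invr_ge0 ler0n.
- by [].
move=> [d [s /stP[_ _ _ nh]] [u /=]]; rewrite in_itv /=; exact: nh.
Qed.

(** * Bounds on the outgoing degree *)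

(** A bound on the numbers of segments is all that the maximum defining
    [outdeg] needs in order to exist, the family of no segments being there. *)
Lemma outdeg_max X p b : (forall m, has_outgoing_segments X p m -> (m <= b)%N) ->
  has_outgoing_segments X p (outdeg X p) /\
  forall m, has_outgoing_segments X p m -> (m <= outdeg X p)%N.
Proof.
move=> bP; pose P m := `[< has_outgoing_segments X p m >].
have P0 : exists m, P m.
  exists 0%N; apply/asboolP; exists (fun _ _ => p).
  by split=> [[]|[]].
have Pb m : P m -> (m <= b)%N by move=> /asboolP /bP.
suff : [set k | has_outgoing_segments X p k /\
         forall m, has_outgoing_segments X p m -> (m <= k)%N] (outdeg X p) by [].
case: (ex_maxnP P0 Pb) => k /asboolP Pk kmax.
by apply: (xgetPex 0%N); exists k; split=> // m /asboolP; exact: kmax.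
Qed.

(** Internally disjoint segments start in distinct directions, since two
    segments with the same first direction overlap near [p]. *)
Lemma outgoing_segments_le X p m : has_outgoing_segments X p m ->
  (m <= #|[set d | `[< exists2 s, departs p d s & ~ germ_in X d s >]]%SET|)%N.
Proof.
move=> [g [gX gdisj]].
have [f fP] := choice (fun i => segment_germ (gX i)).
rewrite -[m in (m <= _)%N]card_ord -(card_imset _ (f := f)).
  apply/subset_leq_card/fintype.subsetP => _ /imsetP[i _ ->].
  rewrite inE; apply/asboolP; have [s [ds sg]] := fP i.
  exists s => // sX; have [t [[w /= /andP[w0 w1] <-]]] := filter_ex (filterI sg sX).
  by have [_ _ _] := gX i; apply; rewrite w0 ltW.
move=> i j fij; have [s [ds sg]] := fP i; have [s' []] := fP j.
rewrite -fij => /(departs_uniq ds) <- sg'.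
apply: gdisj => //; have [t [ti tj]] := filter_ex (filterI sg sg').
by exists (ray (f i) t).
Qed.

(** Together with [outdeg_ge], this compares [outdeg] with numbers of tangent
    directions: a direction that is not locally inside [X] may count, one that
    is locally outside [X] does count.  The two numbers differ only if [X] and
    its complement both accumulate at [p] along some direction. *)
Lemma outdeg_le X p :
  (outdeg X p <=
   #|[set d | `[< exists2 s, departs p d s & ~ germ_in X d s >]]%SET|)%N.
Proof.
by apply: outgoing_segments_le; have [] := outdeg_max (@outgoing_segments_le X p).
Qed.

(** The segments follow the directed edges, over at most half of what remains
    of each, so that segments from both ends of a loop stay disjoint. *)
Lemma outdeg_ge X p :
  (#|[set d | `[< exists2 s, departs p d s & germ_in (~` X) d s >]]%SET|
   <= outdeg X p)%N.
Proof.
set F := [set d | _]%SET.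
apply: (outdeg_max (@outgoing_segments_le X p)).2.
have cut d : exists sl : R * R, d \in F ->
    [/\ departs p d sl.1, 0 < sl.2, sl.1 + 2 * sl.2 <= len d.1 &
        forall t, sl.1 < t <= sl.1 + sl.2 -> ~ X (ray d t)].
  have [dF|] := boolP (d \in F); last by exists 0.
  have := dF; rewrite inE => /asboolP[s ds].
  have /andP[s0 sl] := ds.1.
  move=> /(germ_inP _ sl)[r /andP[sr rl] rX].
  (* Halving keeps a segment in the germ outside [X] and, since [r] is at most
     the length, within half of the rest of the edge. *)
  exists (s, (r - s) / 2) => _; split=> //=; [lra|lra|].
  by move=> t /andP[st tr]; apply: rX; apply/andP; split; lra.
have [sl slP] := choice cut.
pose g (i : 'I_#|F|) t :=
  ray (enum_val i) ((sl (enum_val i)).1 + t * (sl (enum_val i)).2).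
exists g; split=> [i|i j _ _ [_ [[t /= /andP[t0 t1] <-] [t' /= /andP[t0' t1'] gij]]]].
  have [[/andP[s0 sm] ds] l0 ll nX] := slP _ (enum_valP i); split.
  - apply: continuous_subspaceT => t.
    apply: (@continuous_comp R R (points G)
      (fun t => (sl (enum_val i)).1 + t * (sl (enum_val i)).2) (ray (enum_val i))).
      by apply: cvgD; [exact: cvg_cst|apply: cvgMl; exact: cvg_id].
    exact: ray_continuous.
  - move=> t t'; rewrite !in_itv /= => /andP[t0 t1] /andP[t0' t1'].
    move: s0 sm l0 ll; rewrite /g.
    set s := (sl _).1; set l := (sl _).2 => s0 sm l0 ll /ray_inj tt'.
    have {tt'} : s + t * l = s + t' * l by apply: tt'; apply/andP; split; nra.
    by move/addrI/mulIf; apply; rewrite gt_eqF.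
  - by rewrite /g mul0r addr0.
  - move=> t /andP[t0 t1]; apply: nX; rewrite ltrDl mulr_gt0 //= lerD2l.
    by rewrite ler_piMl // ltW.
apply: enum_val_inj; move: gij; rewrite /g.
have [[/andP[]]] := slP _ (enum_valP i); have [[/andP[]]] := slP _ (enum_valP j).
move: (enum_val i) (enum_val j) => d d'.
case: (sl d) (sl d') => [s l] [s' l'] /= s0' sm' ds' l0' ll' nX' s0 sm ds l0 ll nX.
have [l1 l2] : 0 < t * l /\ t * l < l.
  by rewrite mulr_gt0 // gtr_pMl.
have [l1' l2'] : 0 < t' * l' /\ t' * l' < l'.
  by rewrite mulr_gt0 // gtr_pMl.
move=> /esym/ray_eq [|[-> _] //|[dd' e']]; first by apply/andP; split; lra.
(* The two segments lie on the same edge in opposite directions: they start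
   either from the two ends of a loop or from the same interior point. *)
exfalso; move: ds' s0' sm' ll' e'; rewrite dd' ray_flip /= => ds' s0' sm' ll' e'.
move: s0; rewrite le_eqVlt => /predU1P[s0|s0].
  move: ds; rewrite -s0 ray0 -ds' => /esym du.
  have [s's|] := ltP 0 s'; last by lra.
  by apply: (ray_neq_vertex _ du); apply/andP; split; lra.
have /ray_eq : 0 < s < len d.1 by rewrite s0.
move=> /(_ d (len d.1 - s')); rewrite ds ds' => /(_ erefl)[[_]|[]]; first by lra.
by case: (d) => e [].
Qed.

Lemma outdeg_sub X p (A : {set edge G * bool}) :
  (forall d s, departs p d s -> ~ germ_in X d s -> d \in A) ->
  (outdeg X p <= #|A|)%N.
Proof.
move=> sub; apply: leq_trans (outdeg_le X p) _; apply/subset_leq_card/fintype.subsetP.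
by move=> d; rewrite inE => /asboolP[s]; exact: sub.
Qed.

Lemma outdeg_gt0 X p d s : departs p d s -> germ_in (~` X) d s ->
  (0 < outdeg X p)%N.
Proof.
move=> ds dX; apply: leq_trans (outdeg_ge X p).
by rewrite card_gt0; apply/set0Pn; exists d; rewrite inE; apply/asboolP; exists s.
Qed.

Lemma germ_boundary X p d s : X p -> departs p d s -> germ_in (~` X) d s ->
  boundary X p.
Proof.
move=> Xp ds dX; split; first exact: subset_closure.
by move=> /nbhs_germ-/(_ _ _ ds)/germ_inC; apply.
Qed.

End Topology.

(** * Chips on the edges *)

Lemma card_sumZ (T : finType) (A : {set T}) : #|A|%:Z = \sum_(i in A) 1.
Proof. by rewrite sumr_const natz. Qed.

Lemma cardI_sumZ (T : finType) (A B : {set T}) :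
  #|A :&: B|%:Z = \sum_(i in A) (i \in B)%:Z.
Proof.
rewrite card_sumZ (eq_bigl _ _ (fun i => finset.in_setI i A B)) big_mkcondr.
by apply: eq_bigr => i _; case: ifP.
Qed.

Section Chips.
Context {R : realType} (G : metric_graph R) (D : divisor G).
Implicit Types (e : edge G) (p q : points G).

Lemma divisor_sumD1 (A : set (points G)) p : A p ->
  \sum_(q \in A) D q = D p + \sum_(q \in A `\ p) D q.
Proof.
move=> Ap; have supp B q : (B `\` (B `&` [set` (p |` finsupp D)%fset])) q -> D q = 0.
  move=> [Bq /not_andP[//|/negP]].
  by rewrite in_fset1U negb_or mem_finsupp negbK => /andP[_ /eqP].
rewrite -(fsbig_widen (A `&` [set` (p |` finsupp D)%fset])) //; last exact: supp.
rewrite (fsbigD1 p); last 2 first.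
- by apply: finite_setIr; exact: finite_fset.
- by split=> //=; rewrite fset1U1.
congr (_ + _); apply: fsbig_widen; first by move=> q [[]].
by move=> q [[Aq qp] nq]; apply: (supp A); split=> // -[_ /= qD]; apply: nq.
Qed.

Lemma divisor_sum_neq0 (A : set (points G)) :
  \sum_(q \in A) D q != 0 -> exists2 q, A q & D q != 0.
Proof.
move=> S0; apply: contrapT => nA; case/eqP: S0; apply: fsbig1 => q Aq.
by apply/eqP; apply: contrapT => /negP Dq; apply: nA; exists q.
Qed.

Variable v : vert G.
Hypothesis D_ge0 : forall q : points G, q != vertex v -> 0 <= D q.

Lemma D_interior_ge0 e p : edge_interior e p -> 0 <= D p.
Proof.
move=> [t /= ti <-]; apply: D_ge0; apply/eqP.
exact: (@ray_neq_vertex _ _ (e, false)).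
Qed.

Lemma edge_chips_ge0 e : 0 <= edge_chips D e.
Proof. by apply: fsumr_ge0 => q; exact: D_interior_ge0. Qed.

Lemma edge_chips_ge e p : edge_interior e p -> D p <= edge_chips D e.
Proof.
move=> ep; rewrite /edge_chips (divisor_sumD1 ep) lerDl.
by apply: fsumr_ge0 => q [/D_interior_ge0].
Qed.

Lemma edge_chips_ge2 e p q : edge_interior e p -> edge_interior e q -> p <> q ->
  D p + D q <= edge_chips D e.
Proof.
move=> ep eq pq; rewrite /edge_chips (divisor_sumD1 ep) lerD2l.
rewrite (@divisor_sumD1 _ q); last by split=> // /esym.
rewrite lerDl.
by apply: fsumr_ge0 => ? [[/D_interior_ge0]].
Qed.

Lemma edge_chips_gt0 e : 0 < edge_chips D e ->
  exists2 p, edge_interior e p & 0 < D p.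
Proof.
move=> /lt0r_neq0/divisor_sum_neq0[p ep p0]; exists p => //.
by rewrite lt_neqAle eq_sym p0 (D_interior_ge0 ep).
Qed.

Lemma edge_chips_gt1 e : 1 < edge_chips D e ->
  exists p q, [/\ edge_interior e p, edge_interior e q, 0 < D p, 0 < D q &
    p = q -> 1 < D p].
Proof.
move=> chips; have [p ep p0] := edge_chips_gt0 (lt_trans ltr01 chips).
have [p1|p1] := ltP 1 (D p); first by exists p, p.
move: chips; rewrite /edge_chips (divisor_sumD1 ep) => chips.
have /divisor_sum_neq0[q [eq qp] q0] : \sum_(q \in edge_interior e `\ p) D q != 0.
  by apply/eqP => S0; rewrite S0 addr0 ltNge p1 in chips.
exists p, q; split=> // [|pq]; last by case: qp.
by rewrite lt_neqAle eq_sym q0 (D_interior_ge0 eq).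
Qed.

(** [chips_before] and [edges_before] depend on the order only through the set
    of vertices preceding [b].  With that set as an argument, the order can be
    built one vertex at a time. *)
Definition edges_between (S : {set vert G}) (u : vert G) : {set edge G} :=
  [set e | [exists w, (w \in S) && joins e w u]]%SET.

Definition chips_from (S : {set vert G}) (u : vert G) : int :=
  D (vertex u) + \sum_(e in edges_between S u) edge_chips D e.

Lemma edges_beforeE (prec : rel (vert G)) b u :
  edges_before prec b u = #|edges_between [set w | prec w b]%SET u|.
Proof.
apply: eq_card => e; rewrite !inE; apply: eq_existsb => w; by rewrite !inE.
Qed.

Lemma joins_uniq (e : edge G) w w' u : w != u -> w' != u ->
  joins e w u -> joins e w' u -> w = w'.
Proof.
move=> /eqP wu /eqP wu' /orP[]/andP[/eqP es /eqP et] /orP[]/andP[/eqP es' /eqP et'];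
  congruence.
Qed.

(** An edge from [u] to the set of predecessors of [b] has only one end there,
    since [u] is not in that set; the double sum thus counts each edge once. *)
Lemma chips_beforeE (prec : rel (vert G)) b u : ~~ prec u b ->
  chips_before prec D b u = chips_from [set w | prec w b]%SET u.
Proof.
move=> ub; congr (_ + _).
rewrite (exchange_big_dep (mem (edges_between [set w | prec w b]%SET u))) /=; last first.
  by move=> w e wb jw; rewrite inE; apply/existsP; exists w; rewrite inE wb.
apply: eq_bigr => e; rewrite inE => /existsP[w]; rewrite inE => /andP[wb jw].
rewrite (big_pred1 w) // => w'; apply/andP/eqP => [[wb' jw']|->//].
by apply: (joins_uniq _ _ jw' jw); apply: contraNneq ub => <-.
Qed.

End Chips.

(** * Orders yield reduced divisors *)

Section Sufficiency.
Context {R : realType} (G : metric_graph R).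
Implicit Types (e : edge G) (d : edge G * bool) (p q : points G) (X : set (points G)).

Variables (D : divisor G) (v : vert G).
Hypothesis D_ge0 : forall q : points G, q != vertex v -> 0 <= D q.

(** The edges arriving at [u] from outside [X] either leave [X] right at [u],
    and are counted by the outgoing degree, or leave [X] at an interior point,
    which being saturated carries a chip. *)
Lemma unsaturated_vertex X u (S : {set vert G}) : closed X ->
  X (vertex u) -> u != v -> (forall w, w \in S -> ~ X (vertex w)) ->
  chips_from D S u < #|edges_between S u|%:Z ->
  exists2 q, boundary X q & ~ saturated X D q.
Proof.
move=> clX Xu uv SX lt_; apply: contrapT => sat.
have {}sat q : boundary X q -> saturated X D q.
  by move=> bq; apply: contrapT => nq; apply: sat; exists q.
pose F := [set d | `[< exists2 s, departs (vertex u) d s & germ_in (~` X) d s >]]%SET.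
pose F1 := [set d.1 | d in F]%SET.
have EF e : e \in edges_between S u -> 1 <= (e \in F1)%:Z + edge_chips D e.
  rewrite inE => /existsP[w /andP[wS /edge_directed[b [eu ew]]]].
  have [|||c [/andP[c0 cl] Xc germc]] := @last_exit _ _ X (e, b) 0 clX.
  - by rewrite lexx len_gt0.
  - by rewrite ray0 eu.
  - by rewrite ray_ge_len // ew; exact: SX.
  have dc : departs (ray (e, b) c) (e, b) c by apply: departs_ray; rewrite c0.
  move: c0; rewrite le_eqVlt => /predU1P[c0|c0].
    suff -> : e \in F1 by rewrite lerDl (edge_chips_ge0 D_ge0).
    apply/imsetP; exists (e, b) => //; rewrite inE; apply/asboolP; exists c => //.
    by move: dc; rewrite -[in ray _ _]c0 ray0 eu.
  have ec : edge_interior e (ray (e, b) c).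
    by apply: (@ray_interior _ _ (e, b)); rewrite c0.
  have := edge_chips_ge D_ge0 ec.
  have := sat _ (germ_boundary Xc dc germc).
  have := outdeg_gt0 dc germc.
  by rewrite /saturated; lia.
have : #|edges_between S u|%:Z <=
    #|edges_between S u :&: F1|%:Z + \sum_(e in edges_between S u) edge_chips D e.
  by rewrite card_sumZ cardI_sumZ -big_split; apply: ler_sum.
have := subset_leq_card (finset.subsetIr (edges_between S u) F1) => EF1 Eu.
have FF : (#|F1| <= #|F|)%N by exact: leq_imset_card.
have uD : D (vertex u) < #|F|%:Z by rewrite /chips_from in lt_; lia.
have D0 : 0 <= D (vertex u) by apply: D_ge0; apply: contra uv => /eqP[->].
have [d] : exists d, d \in F by apply/set0Pn; rewrite -card_gt0; lia.
rewrite inE => /asboolP[s ds dX].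
have := sat _ (germ_boundary Xu ds dX).
by have := outdeg_ge X (vertex u); rewrite -/F /saturated; lia.
Qed.

(** The extreme points of [X] on the edge are boundary points; were they
    saturated, they would carry two chips, counted at a single point if [X]
    meets the edge there only. *)
Lemma unsaturated_edge X e t : closed X -> edge_chips D e <= 1 ->
  0 < t < len e -> X (chart e t) -> ~ X (vertex (src e)) -> ~ X (vertex (tgt e)) ->
  exists2 q, boundary X q & ~ saturated X D q.
Proof.
move=> clX e1 /andP[t0 tl] Xt nXs nXt; apply: contrapT => sat.
have {}sat q : boundary X q -> saturated X D q.
  by move=> bq; apply: contrapT => nq; apply: sat; exists q.
have [|||b [/andP[tb bl] Xb bX]] := @last_exit _ _ X (e, false) t clX.
- by rewrite /= tl ltW.
- exact: Xt.
- by rewrite ray_ge_len.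
have [|||a [/andP[ta al] Xa aX]] := @last_exit _ _ X (e, true) (len e - t) clX.
- by rewrite /= subr_ge0 ltW //= ltrBlDr ltrDl.
- by rewrite /ray /= subKr.
- by rewrite ray_ge_len.
rewrite /= in tb bl ta al Xa Xb.
have db : departs (ray (e, false) b) (e, false) b.
  by apply: departs_ray; apply/andP; split=> //=; lra.
have da : departs (ray (e, true) a) (e, true) a.
  by apply: departs_ray; apply/andP; split=> //=; lra.
have ia : edge_interior e (ray (e, true) a).
  by apply: (@ray_interior _ _ (e, true)); apply/andP; split=> //=; lra.
have ib : edge_interior e (ray (e, false) b).
  by apply: (@ray_interior _ _ (e, false)); apply/andP; split=> //=; lra.
have sa := sat _ (germ_boundary Xa da aX).
have sb := sat _ (germ_boundary Xb db bX).
have [ab|ab] := pselect (ray (e, true) a = ray (e, false) b); last first.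
  have := edge_chips_ge2 D_ge0 ia ib ab.
  move: (outdeg_gt0 da aX) (outdeg_gt0 db bX) sa sb; rewrite /saturated.
  by lia.
have := edge_chips_ge D_ge0 ia.
suff : (1 < outdeg X (ray (e, true) a))%N by move: sa; rewrite /saturated; lia.
apply: leq_trans (outdeg_ge X _).
have <- : #|[set (e, true); (e, false)]%SET| = 2%N by rewrite cards2 xpair_eqE andbF.
apply/subset_leq_card/fintype.subsetP => d; rewrite in_set2 => /orP[] /eqP ->;
  rewrite inE; apply/asboolP.
  by exists a.
by exists b; rewrite // ab.
Qed.

(** The first vertex of [X] for the order has no predecessor in [X]. *)
Lemma reduced_of_order (prec : rel (vert G)) :
  (forall e, edge_chips D e <= 1) -> order_from v prec ->
  (forall u, u != v -> Dtilde prec D u < (dtilde prec u)%:Z) ->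
  reduced (vertex v) D.
Proof.
move=> e1 [irr tr _ _] tilde; split=> // X [x Xx] clX _ nXv.
have [[u0 Xu0]|nXu] := pselect (exists u, X (vertex u)); last first.
  have [[u xu]|[e [t [ti xt]]]] := pointP x; first by case: nXu; exists u; rewrite -xu.
  apply: (@unsaturated_edge X e t); rewrite -?xt // => ?; apply: nXu.
    by exists (src e).
  by exists (tgt e).
pose S u := [set w | prec w u]%SET.
pose inX u := `[< X (vertex u) >].
have iu0 : inX u0 by apply/asboolP.
case: (arg_minnP (fun u => #|S u|) iu0) => u /asboolP Xu umin.
have uv : u != v by apply/eqP => uv; apply: nXv; rewrite -uv.
apply: (@unsaturated_vertex X u (S u)) => //.
  move=> w; rewrite inE => wu Xw.
  have : (#|S w| < #|S u|)%N.
    apply: proper_card; apply/properP; split.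
      by apply/fintype.subsetP => z; rewrite !inE => /tr; apply.
    by exists w; rewrite !inE // irr.
  by rewrite ltnNge umin //; apply/asboolP.
by rewrite -chips_beforeE ?irr // -edges_beforeE; exact: tilde.
Qed.

End Sufficiency.

(** * Burning: reduced divisors are covered by fire from [v] *)

Section Necessity.
Context {R : realType} (G : metric_graph R).
Implicit Types (e : edge G) (d : edge G * bool) (p q : points G) (X : set (points G)).

Variables (D : divisor G) (v : vert G).
Hypothesis redD : reduced (vertex v) D.

(** Asking for saturation off the boundary as well spares the computation of
    the boundary, and costs nothing as the outgoing degree is zero there. *)
Lemma reduced_sat X q : closed X -> connected X -> X q -> ~ X (vertex v) ->
  (forall p, X p -> saturated X D p) -> False.
Proof.
move=> clX cX Xq nXv sat; have [p /(boundary_sub clX)/sat//] : exists2 p,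
  boundary X p & ~ saturated X D p by apply: redD.2 => //; exists q.
Qed.

(** Two chips on an edge, possibly at the same point, saturate the segment
    between them. *)
Lemma reduced_edge e : edge_chips D e <= 1.
Proof.
rewrite leNgt; apply/negP => /(edge_chips_gt1 redD.1)[p0 [q0 []]].
move=> /(@interior_ray _ _ (e, false))[a0 ai0 ->].
move=> /(@interior_ray _ _ (e, false))[b0 bi0 ->] Da0 Db0 D20.
have [a [b [ai bi ab [Da Db D2]]]] : exists a b,
    [/\ 0 < a < len e, 0 < b < len e, a <= b &
    [/\ 0 < D (ray (e, false) a), 0 < D (ray (e, false) b) &
        a = b -> 1 < D (ray (e, false) a)]].
  have [ab|ba] := leP a0 b0.
    by exists a0, b0; split=> //; split=> // ab'; apply: D20; rewrite ab'.
  by exists b0, a0; split=> //; [exact: ltW|split=> // ba'; exfalso; lra].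
clear a0 b0 ai0 bi0 Da0 Db0 D20; set d := (e, false) in Da Db D2 *.
pose X := [set ray d t | t in `[a, b]].
have [/andP[a0' al] /andP[b0' bl]] := (ai, bi).
apply: (@reduced_sat X (ray d a)).
- by apply: closed_ray; exact: ltW.
- exact: connected_ray.
- by exists a; rewrite //= in_itv /= lexx.
- move=> [t /=]; rewrite in_itv /= => /andP[at_ tb]; apply: ray_neq_vertex.
  by apply/andP; split=> /=; lra.
move=> p [t /=]; rewrite in_itv /= => /andP[at_ tb] <- {p}.
have ti : 0 < t < len d.1 by apply/andP; split=> /=; lra.
pose A := ((if t == b then [set d] else finset.set0) :|:
           (if t == a then [set flip d] else finset.set0))%SET.
have outA : (outdeg X (ray d t) <= #|A|)%N.
  apply: outdeg_sub => d' s /(departs_interior ti) [] [-> ->] nX; rewrite !inE.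
    case: eqP => [_|/eqP tb']; first by rewrite inE eqxx.
    have {}tb : t < b by rewrite lt_neqAle tb'.
    case: nX; rewrite /germ_in; near=> w; exists w => //=; rewrite in_itv /=.
    apply/andP; split; first by apply: (le_trans at_); near: w; exact: nbhs_right_ge.
    by near: w; exact: nbhs_right_le.
  case: (t =P a) => [_|/eqP ta]; first by rewrite !inE eqxx orbT.
  have {}at_ : a < t by rewrite lt_neqAle eq_sym ta.
  case: nX; rewrite /germ_in; near=> w; exists (len e - w); last by rewrite ray_flip.
  have ? : len e - t < w by near: w; exact: nbhs_right_gt.
  have ? : w < len e - a by near: w; apply: nbhs_right_lt => /=; lra.
  by rewrite /= in_itv /=; apply/andP; split; lra.
have cardA : (#|A| <= (t == b) + (t == a))%N.
  apply: leq_trans (leq_card_setU _ _) _.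
  by apply: leq_add; case: eqP; rewrite ?cards1 ?cards0.
have Dt0 : 0 <= D (ray d t).
  by apply: redD.1; apply/eqP; exact: ray_neq_vertex.
apply: (@le_trans _ _ ((t == b) + (t == a))%N%:Z).
  by rewrite lez_nat; exact: leq_trans cardA.
case: (t =P b) => [tb'|_]; case: (t =P a) => [ta'|_] /=.
- by move: (D2 (etrans (esym ta') tb')); rewrite -ta'; move: (D _); clear; lia.
- by move: Db; rewrite -tb'; move: (D _); clear; lia.
- by move: Da; rewrite -ta'; move: (D _); clear; lia.
- exact: Dt0.
Unshelve. all: by end_near. Qed.

(** Dhar's burning process.  The vertices of [S] are burnt, and the fire has
    spread from them along the edges until it meets a chip.  If at every unburnt
    vertex [u] the chips of [u] and of the edges from [S] to [u] are at least as
    many as these edges, then each connected component of what is left is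
    saturated. *)
Section Burning.
Variable S : {set vert G}.
Hypotheses (Sv : v \in S)
  (Dsat : forall u, u \notin S -> #|edges_between S u|%:Z <= chips_from D S u).

(** How far the unburnt set extends along a directed edge starting at an
    unburnt vertex: up to the other end if it is unburnt too, otherwise up to
    the chip, and not at all when there is no chip. *)
Lemma fire_reach d : exists t, tail d \notin S ->
  [/\ 0 <= t <= len d.1,
      t = len d.1 -> tail (flip d) \notin S,
      0 < t < len d.1 -> 0 < D (ray d t) &
      t = 0 -> tail (flip d) \in S /\ edge_chips D d.1 <= 0].
Proof.
have l0 := len_gt0 d.1.
have [tS|tS] := boolP (tail (flip d) \in S); last first.
  exists (len d.1) => _; split=> //; first by rewrite lexx ltW.
  - by rewrite ltxx andbF.
  - by move=> l1; rewrite l1 ltxx in l0.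
have [chips|chips] := leP (edge_chips D d.1) 0; last first.
  have [p /interior_ray[t /andP[t0 tl] ->] Dp] := edge_chips_gt0 redD.1 chips.
  exists t => _; split=> // [|tl'|t0']; first by rewrite !ltW.
    by rewrite tl' ltxx in tl.
  by rewrite t0' ltxx in t0.
exists 0 => _; split=> // [|tl'|]; first by rewrite lexx ltW.
  by rewrite -tl' ltxx in l0.
by rewrite ltxx.
Qed.

Definition reach := projT1 (choice fire_reach).

Lemma reachP d : tail d \notin S ->
  [/\ 0 <= reach d <= len d.1,
      reach d = len d.1 -> tail (flip d) \notin S,
      0 < reach d < len d.1 -> 0 < D (ray d (reach d)) &
      reach d = 0 -> tail (flip d) \in S /\ edge_chips D d.1 <= 0].
Proof. exact: (projT2 (choice fire_reach)). Qed.

(** The first union is there for the vertices without edges.  An edge between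
    two burnt vertices is left out altogether, even if it carries a chip. *)
Definition unburnt : set (points G) :=
  \bigcup_(u in [set u | u \notin S]) [set vertex u] `|`
  \bigcup_(d in [set d | tail d \notin S]) [set ray d t | t in `[0, reach d]].

Lemma closed_unburnt : closed unburnt.
Proof.
apply: closedU; apply: closed_bigcup => [|x /= xS]; try exact: finite_finset.
  exact: closed_vertex.
by have [/andP[? ?] _ _ _] := reachP xS; apply: closed_ray.
Qed.

Lemma unburntP q : unburnt q -> (exists2 u, u \notin S & q = vertex u) \/
  exists d t, [/\ tail d \notin S, 0 < t < len d.1, t <= reach d & q = ray d t].
Proof.
move=> [[u /= uS ->]|[d /= dS [t /=]]]; first by left; exists u.
rewrite in_itv /= => /andP[]; rewrite le_eqVlt => /predU1P[<- _ <-|t0 tr <-].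
  by left; exists (tail d); rewrite ?ray0.
have [/andP[r0 rl] rS _ _] := reachP dS.
have [tl|lt_] := ltP t (len d.1); last first.
  left; exists (tail (flip d)); last by rewrite ray_ge_len.
  by apply: rS; apply/eqP; rewrite eq_le rl (le_trans lt_ tr).
by right; exists d, t; rewrite t0 tl.
Qed.

Lemma unburnt_vertex u : unburnt (vertex u) -> u \notin S.
Proof.
by case/unburntP => [[w wS [->]]|[d [t [_ ti _ /esym/(ray_neq_vertex ti)]]]].
Qed.

(** Components absorb the rays of [unburnt] that they meet; this takes the place
    of local connectedness. *)
Lemma ray_in_component X q d a b s :
  X = connected_component unburnt q -> X (ray d s) ->
  a <= s <= b -> (forall t, a <= t <= b -> unburnt (ray d t)) ->
  forall t, a <= t <= b -> X (ray d t).
Proof.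
move=> -> /[dup] Xs /same_connected_component -> sab abY t tab.
apply: (@connected_component_max _ _ [set ray d t | t in `[a, b]]).
- by exists s; rewrite //= in_itv.
- by move=> p [w /=]; rewrite in_itv /= => /abY ? <-.
- exact: connected_ray.
- by exists t; rewrite //= in_itv.
Qed.

(** At an interior point, only the direction of the fire may leave [X], and
    then the point carries the chip that stopped the fire.  At a vertex, the
    directions that leave [X] are those of the chipless edges to [S], and there
    are at most [D (vertex u)] of them as each other edge to [S] has one chip. *)
Lemma unburnt_saturated X x q : X = connected_component unburnt x -> X q ->
  saturated X D q.
Proof.
move=> Xx Xq; rewrite /saturated.
have Yq : unburnt q by move: Xq; rewrite Xx => /connected_component_sub.
have reachY d : tail d \notin S -> forall t, 0 <= t <= reach d -> unburnt (ray d t).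
  by move=> dS t tr; right; exists d => //; exists t; rewrite //= in_itv.
have [[u uS qu]|[d [t [dS /[dup] ti /andP[t0 tl] tr qt]]]] := unburntP Yq; last first.
  have [/andP[r0 rl] _ rD _] := reachP dS.
  have Xr w : 0 <= w <= reach d -> X (ray d w).
    apply: (@ray_in_component X x d 0 (reach d) t) => //; rewrite -?qt //.
      by rewrite ltW.
    exact: reachY.
  have back : germ_in X (flip d) (len d.1 - t).
    rewrite /germ_in; near=> w; rewrite ray_flip; apply: Xr.
    have ? : len d.1 - t < w by near: w; exact: nbhs_right_gt.
    have ? : w < len d.1 by near: w; apply: nbhs_right_lt; lra.
    by apply/andP; split; lra.
  have [tr'|rt] := ltP t (reach d).
    have -> : outdeg X q = 0%N.
      apply/eqP; rewrite -leqn0 -(cards0 (edge G * bool)%type).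
      apply: outdeg_sub => d' s; rewrite qt => /(departs_interior ti)[] [-> ->] // [].
      rewrite /germ_in; near=> w; apply: Xr.
      have ? : t < w by near: w; exact: nbhs_right_gt.
      have ? : w < reach d by near: w; exact: nbhs_right_lt.
      by apply/andP; split; lra.
    by apply: redD.1; rewrite qt; apply/eqP; exact: ray_neq_vertex.
  have tr' : t = reach d by apply/eqP; rewrite eq_le tr.
  have : 0 < D q by rewrite qt tr'; apply: rD; rewrite -tr'.
  move=> Dq; apply: (@le_trans _ _ 1) => //; rewrite lez_nat.
  rewrite -(cards1 d); apply: outdeg_sub => d' s.
  by rewrite qt inE => /(departs_interior ti)[] [-> ->]; rewrite ?eqxx.
pose A := [set d | [&& tail d == u, tail (flip d) \in S & edge_chips D d.1 <= 0]]%SET.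
have outA : (outdeg X q <= #|A|)%N.
  apply: outdeg_sub => d s; rewrite qu => /departs_vertex[-> du] nX; rewrite inE du eqxx.
  have dS : tail d \notin S by rewrite du.
  have [/andP[r0 rl] _ _ r0P] := reachP dS.
  move: (r0); rewrite le_eqVlt => /predU1P[/esym/r0P[-> ->]//|r0'].
  case: nX; rewrite /germ_in; near=> w.
  apply: (@ray_in_component X x d 0 (reach d) 0) => //.
  - by rewrite ray0 du -qu.
  - by rewrite lexx.
  - exact: reachY.
  apply/andP; split; first by near: w; exact: nbhs_right_ge.
  by near: w; exact: nbhs_right_le.
pose B := [set e | edge_chips D e <= 0]%SET.
have AB : (#|A| <= #|edges_between S u :&: B|)%N.
  rewrite -(card_in_imset (f := fst) (D := A)).
    apply/subset_leq_card/fintype.subsetP => _ /imsetP[d + ->].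
    rewrite !inE => /and3P[/eqP du dS ->]; rewrite andbT.
    apply/existsP; exists (tail (flip d)); rewrite dS -du /joins /tail /=.
    by case: d.2; rewrite !eqxx ?orbT.
  move=> [e b] [e' b']; rewrite !inE /= => /and3P[/eqP du dS _] /and3P[/eqP du' dS' _] ee.
  rewrite -ee in du' dS' *; congr pair; apply/eqP; apply: contraTT isT => bb.
  move: uS; rewrite -du (_ : b = ~~ b') ?dS' //.
  by case: b b' bb {du dS du' dS'} => [] [].
have := Dsat uS; rewrite /chips_from qu in outA *.
have : #|edges_between S u :&: B|%:Z <= #|edges_between S u|%:Z -
    \sum_(e in edges_between S u) edge_chips D e.
  rewrite cardI_sumZ card_sumZ -sumrB; apply: ler_sum => e _; rewrite inE.
  by have := reduced_edge e; case: leP => /=; lia.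
by move: outA AB; lia.
Unshelve. all: by end_near. Qed.

Lemma all_burnt u : u \in S.
Proof.
apply: contraT => uS; exfalso.
have Yu : unburnt (vertex u) by left; exists u.
apply: (@reduced_sat (connected_component unburnt (vertex u)) (vertex u)).
- exact/component_closed/closed_unburnt.
- exact: component_connected.
- exact: connected_component_refl.
- by move=> /connected_component_sub/unburnt_vertex; rewrite Sv.
- by move=> q; exact: unburnt_saturated.
Qed.

End Burning.

End Necessity.

(** * The burning order *)

Section GreedyOrder.
Context {R : realType} (G : metric_graph R) (v : vert G).
Variable next : {set vert G} -> vert G -> Prop.
Hypothesis next_ex : forall S : {set vert G}, v \in S -> S != [set: vert G]%SET ->
  exists2 u, u \notin S & next S u.

(** The order is listed as a sequence [v :: s], grown at its end; [next S u]
    says that [u] may be chosen right after the vertices of [S]. *)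
Lemma greedy_seq n : (n < #|vert G|)%N -> exists s : seq (vert G),
  [/\ uniq (v :: s), size s = n &
      forall s1 u s2, s = s1 ++ u :: s2 -> next [set w in v :: s1]%SET u].
Proof.
elim: n => [_|n IHn nV].
  by exists [::]; split=> // -[].
have [s [us sn sP]] := IHn (ltnW nV).
have [||u uS nu] := @next_ex [set w in v :: s]%SET.
- by rewrite inE mem_head.
- apply: contraTneq nV => sT; rewrite -leqNgt -cardsT -sT cardsE.
  by rewrite (card_uniqP us) /= sn.
rewrite inE in uS.
exists (rcons s u); split; first by rewrite -rcons_cons rcons_uniq uS.
  by rewrite size_rcons sn.
move=> s1 w s2; case/lastP: s2 => [|s2 z].
  by rewrite cats1 => /rcons_inj[<- <-].
by rewrite -rcons_cons -rcons_cat => /rcons_inj[/sP].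
Qed.

Lemma greedy_order : exists2 prec : rel (vert G), order_from v prec &
  forall u, u != v -> next [set w | prec w u]%SET u.
Proof.
have V0 : (0 < #|vert G|)%N by apply/card_gt0P; exists v.
have [|s [us sn sP]] := @greedy_seq #|vert G|.-1; first by rewrite prednK.
have allV : v :: s =i predT.
  apply/subset_cardP; last by apply/fintype.subsetP.
  by rewrite (card_uniqP us) /= sn prednK.
exists (fun u w => index u (v :: s) < index w (v :: s))%N.
  split=> [u|w u z|u w uw|u uv]; first exact: ltnn.
  - exact: ltn_trans.
  - rewrite -neq_ltn; apply: contra uw => /eqP uw; apply/eqP.
    by rewrite -(nth_index v (allV u)) uw nth_index ?allV.
  - by rewrite /= eqxx eq_sym (negbTE uv).
move=> u uv; have : u \in v :: s by rewrite allV.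
rewrite in_cons (negbTE uv) /= => us'.
have [s1 [s2 se]] : exists s1 s2, s = s1 ++ u :: s2.
  by case/splitPr: us' => s1 s2; exists s1, s2.
suff -> : [set w | (index w (v :: s) < index u (v :: s))%N]%SET =
          [set w in v :: s1]%SET by exact: sP se.
apply/setP => w; rewrite !inE -in_cons se -!cat_cons.
have nu : u \notin v :: s1.
  move: us; rewrite se -cat_cons cat_uniq => /and3P[_ /hasPn/(_ u) + _].
  by rewrite mem_head; apply.
rewrite !index_cat (negbTE nu) /= eqxx addn0 -/(index w (v :: s1)).
rewrite -[in RHS]index_mem; case: ifP => [//|wn].
by rewrite index_mem wn ltnNge leq_addr.
Qed.

End GreedyOrder.

Section Reduced.
Context {R : realType} (G : metric_graph R) (v : vert G) (D : divisor G).

(** Taking, among the vertices that can burn, one with the fewest chips is what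
    makes the order satisfy the minimality condition as well. *)
Lemma burning_step (S : {set vert G}) : reduced (vertex v) D ->
  v \in S -> S != [set: vert G]%SET ->
  exists2 u, u \notin S &
    chips_from D S u < #|edges_between S u|%:Z /\
    forall w, w \notin S -> chips_from D S w < #|edges_between S w|%:Z ->
      chips_from D S u <= chips_from D S w.
Proof.
move=> redD Sv ST.
pose burns u := (u \notin S) && (chips_from D S u < #|edges_between S u|%:Z).
have [u burns_u] : exists u, burns u.
  apply: contrapT => nburn; case/eqP: ST; apply/setP => u; rewrite inE.
  apply: (all_burnt redD Sv) => w wS; rewrite leNgt; apply/negP => lt_.
  by apply: nburn; exists w; rewrite /burns wS.
case: (arg_minP (chips_from D S) burns_u) => w /andP[wS lt_] wmin.
by exists w => //; split=> // z zS ltz; apply: wmin; rewrite /burns zS.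
Qed.

Lemma order_of_reduced : reduced (vertex v) D ->
  exists prec : rel (vert G),
    [/\ order_from v prec,
        forall u : vert G, u != v -> Dtilde prec D u < (dtilde prec u)%:Z &
        forall u w : vert G, u != v -> w != v -> prec u w ->
          chips_before prec D u w < (edges_before prec u w)%:Z ->
          Dtilde prec D u <= chips_before prec D u w].
Proof.
move=> redD.
have [prec ord nextP] := greedy_order (fun S => @burning_step S redD).
have [irr tr _ _] := ord.
exists prec; split=> // [u uv|u w uv wv uw].
  by rewrite /Dtilde /dtilde chips_beforeE ?irr // edges_beforeE; exact: (nextP u uv).1.
have wu : ~~ prec w u by apply/negP => /(tr _ _ _ uw); rewrite irr.
rewrite /Dtilde !chips_beforeE ?irr // edges_beforeE; apply: (nextP u uv).2.
by rewrite inE.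
Qed.

Lemma chips_before_le (prec : rel (vert G)) u w :
  (forall q : points G, q != vertex v -> 0 <= D q) -> order_from v prec ->
  prec u w -> chips_before prec D u w <= Dtilde prec D w.
Proof.
move=> D0 [irr tr _ _] uw; rewrite lerD2l [leRHS]big_mkcond [leLHS]big_mkcond /=.
apply: ler_sum => x _; have [xu|_] := boolP (prec x u); first by rewrite (tr _ _ _ xu uw).
by case: ifP => // _; apply: sumr_ge0 => e _; exact: (edge_chips_ge0 D0).
Qed.

End Reduced.

Theorem theorem13 (R : realType) (G : metric_graph R)
    (Gconn : connected [set: points G]) (v : vert G) (D : divisor G) :
  (reduced (vertex v) D <->
   [/\ forall q : points G, q != vertex v -> 0 <= D q,
       forall e : edge G, edge_chips D e <= 1 &
       exists prec : rel (vert G),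
         [/\ order_from v prec,
             forall u : vert G, u != v -> Dtilde prec D u < (dtilde prec u)%:Z &
             forall u w : vert G, u != v -> w != v -> prec u w ->
               chips_before prec D u w < (edges_before prec u w)%:Z ->
               Dtilde prec D u <= chips_before prec D u w]])
  /\
  ((forall q : points G, q != vertex v -> 0 <= D q) ->
   forall prec : rel (vert G), order_from v prec ->
   forall u w : vert G, u != v -> w != v -> prec u w ->
     chips_before prec D u w <= Dtilde prec D w).
Proof.
split; last by move=> D0 prec ord u w _ _; exact: (chips_before_le D0 ord).
split=> [redD|[D0 e1 [prec [ord tilde _]]]].
  by split; [exact: redD.1|exact: (reduced_edge redD)|exact: (order_of_reduced redD)].
exact: reduced_of_order tilde.
Qed.
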